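(* Let $\mathcal{H}$ be a complex Hilbert space, let $Q\subset\mathbb{C}^n$ be a complete circular domain centered at $0\in Q$, and let $f:Q\to\mathcal{B}(\mathcal{H})$ be given by a series of homogeneous polynomials $f(z)=\sum_{k=0}^{\infty}P_k(z)$ converging in $Q$, such that $\|f(z)\|<1$ for all $z\in Q$ and $f(0)=a_0I$ with $a_0\in\mathbb{C}$, $|a_0|<1$. Then $$\sum_{k=0}^{\infty}\|P_k(z)\|<1$$ for all $z$ in the homothetic domain $(1/3)Q$. Moreover, if $Q$ is convex, the constant $1/3$ is the best possible, i.e. for every $\rho\in(1/3,1)$ there is a function $f:Q\to\mathcal{B}(\mathcal{H})$, given by a series of homogeneous polynomials $f(z)=\sum_{k=0}^{\infty}P_k(z)$ converging in $Q$, with $\|f(z)\|<1$ for all $z\in Q$ and $f(0)=a_0I$ for some $a_0\in\mathbb{C}$, $|a_0|<1$, for which the inequality fails at some point of $\rho Q$.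
   Context: $\mathcal{B}(\mathcal{H})$ is the algebra of all bounded linear operators on $\mathcal{H}$ with the operator norm $\|\cdot\|$, and $I$ is the identity operator. A domain $Q\subset\mathbb{C}^n$ is a complete circular domain centered at $0\in Q$ if for each $z=(z_1,\dots,z_n)\in Q$ and each $\xi\in\mathbb{C}$ with $|\xi|\le 1$ one has $(\xi z_1,\dots,\xi z_n)\in Q$. Every analytic function $f:Q\to\mathcal{B}(\mathcal{H})$ has an expansion $f(z)=\sum_{k=0}^\infty P_k(z)$, where $P_k(z)=\sum_{|\alpha|=k}A_\alpha z^\alpha$, $A_\alpha\in\mathcal{B}(\mathcal{H})$ (standard multi-index notation), is a homogeneous polynomial of degree $k$ and $P_0(z)=f(0)$. For $\rho>0$, $\rho Q=\{\rho z: z\in Q\}$.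
   Formalization: In the sharpness part, H is assumed nonzero and Q different from the whole of C^n: for H = 0 all norms vanish, and for Q = C^n Liouville's theorem makes every admissible f constant, so the inequality never fails in those cases. *)

(* Defs.v *)
From HB Require Import structures.
From mathcomp Require Import all_boot all_order all_algebra sesquilinear.
From mathcomp Require Import complex.
From mathcomp Require Import all_classical all_reals all_analysis.

Set Implicit Arguments.
Unset Strict Implicit.
Unset Printing Implicit Defensive.

Import Order.TTheory GRing.Theory Num.Theory.
Import numFieldNormedType.Exports.

Local Open Scope classical_set_scope.
Local Open Scope ring_scope.
Local Open Scope complex_scope.

(* The usual topology and norm of the complex field, so that 'rV[R[i]]_n is C^n
   with its usual topology (given by the sup norm). *)
HB.instance Definition _ (R : realType) := NormedModule.copy R[i] R[i]^o.

(* Together with completeness of H, this makes H a Hilbert space.  The form is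
   linear in its first argument. *)
Definition hilbert_product (R : realType) (H : completeNormedModType R[i])
    (dot : {dot H for Num.conj}) : Prop :=
  forall x : H, `|x| ^+ 2 = dot x x.

Section BoundedOperators.
Context {R : realType} {H : normedModType R[i]}.

Definition bounded_linear : {pred H -> H} := fun T =>
  `[< linear T /\ exists M : R[i], forall x, `|T x| <= M * `|x| >].

Record bounded_operator : Type := BoundedOperator {
  bop_fun :> H -> H ;
  bop_funP : bop_fun \in bounded_linear }.

HB.instance Definition _ := [isSub for bop_fun].
HB.instance Definition _ := [Choice of bounded_operator by <:].

Lemma bounded_linearP (T : H -> H) :
  reflect (linear T /\ exists M : R[i], forall x, `|T x| <= M * `|x|)
          (T \in bounded_linear).
Proof. exact: asboolP. Qed.

Lemma bounded_linear_submod : submod_closed bounded_linear.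
Proof.
split.
  apply/bounded_linearP; split=> [a x y|].
    by rewrite /= scaler0 addr0.
  by exists 0 => x; rewrite mul0r normr0.
move=> a S T /bounded_linearP[lS [M hM]] /bounded_linearP[lT [N hN]].
apply/bounded_linearP; split=> [b x y|].
  have E z : (a *: S + T) z = a *: S z + T z by [].
  rewrite !E lS lT !scalerDr !scalerA [b * a]mulrC -!addrA.
  by congr (_ + _); rewrite addrCA.
exists (`|a| * M + N) => x.
apply: (le_trans (ler_normD _ _)); rewrite mulrDl lerD//.
by rewrite normrZ -mulrA ler_wpM2l.
Qed.

HB.instance Definition _ :=
  GRing.isSubmodClosed.Build R[i] (H -> H) bounded_linear bounded_linear_submod.
HB.instance Definition _ :=
  [SubChoice_isSubLmodule of bounded_operator by <:].

Lemma bop_id_bounded : (fun x : H => x) \in bounded_linear.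
Proof. by apply/bounded_linearP; split=> //; exists 1 => x; rewrite mul1r. Qed.

Definition bop_id : bounded_operator := BoundedOperator bop_id_bounded.

(* The norm of a normedModType over R[i] is R[i]-valued (with zero imaginary
   part), hence the real part. *)
Definition opnorm (T : bounded_operator) : R :=
  sup [set complex.Re `|T x| | x in [set x : H | `|x| <= 1]].

Let norm_Re (x : H) : `|x| = (complex.Re `|x|)%:C.
Proof. by have := normr_real x => /complex_realP[k ->]. Qed.

Let abs_Re (a : R[i]) : `|a| = (complex.Re `|a|)%:C.
Proof. by have := normr_real a => /complex_realP[k ->]. Qed.

Let opnorm_has_sup (T : bounded_operator) :
  has_sup [set complex.Re `|T x| | x in [set x : H | `|x| <= 1]].
Proof.
split; first by exists (complex.Re `|T 0|), 0 => //=; rewrite normr0 ler01.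
have /bounded_linearP[_ [M hM]] := bop_funP T.
exists (complex.Re `|M|) => _ [x /= x1 <-].
rewrite -lecR -norm_Re -abs_Re (le_trans (hM x))//.
rewrite -[leLHS]ger0_norm ?(le_trans _ (hM x))//.
by rewrite normrM normr_id ler_piMr.
Qed.

Let opnorm_ge0 (T : bounded_operator) : 0 <= opnorm T.
Proof.
apply: (le_trans (y := complex.Re `|T 0|)); first by rewrite -lecR -norm_Re normr_ge0.
apply: ub_le_sup; first by case: (opnorm_has_sup T).
by exists 0 => //=; rewrite normr0 ler01.
Qed.

Lemma opnorm_le (T : bounded_operator) (x : H) :
  `|T x| <= (opnorm T)%:C * `|x|.
Proof.
have /bounded_linearP[lT [M hM]] := bop_funP T.
have [->|x0] := eqVneq x 0.
  by rewrite (le_trans (hM 0))// normr0 !mulr0.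
have nx : 0 < `|x| by rewrite normr_gt0.
have TZ a y : T (a *: y) = a *: T y.
  have T0 : T 0 = 0.
    by apply/eqP; rewrite -normr_le0 (le_trans (hM 0))// normr0 mulr0.
  by have := lT a y 0; rewrite !addr0 T0 addr0.
have : complex.Re `|T (`|x|^-1 *: x)| <= opnorm T.
  apply: ub_le_sup; first by case: (opnorm_has_sup T).
  by exists (`|x|^-1 *: x) => //=; rewrite normrZ normfV normr_id mulVf ?gt_eqF.
rewrite -lecR -norm_Re TZ normrZ normfV normr_id mulrC.
by rewrite ler_pdivrMr.
Qed.

Lemma opnorm_le_bound (T : bounded_operator) (c : R) : 0 <= c ->
  (forall x, `|T x| <= c%:C * `|x|) -> opnorm T <= c.
Proof.
move=> c0 hc; apply: ge_sup; first by case: (opnorm_has_sup T).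
move=> _ [x /= x1 <-]; rewrite -lecR -norm_Re (le_trans (hc x))//.
by rewrite ler_piMr// lecR.
Qed.

Let bop_norm (T : bounded_operator) : R[i] := (opnorm T)%:C.

Let bop_normD S T : bop_norm (S + T) <= bop_norm S + bop_norm T.
Proof.
rewrite /bop_norm -rmorphD lecR opnorm_le_bound ?addr_ge0// => x.
rewrite rmorphD mulrDl (le_trans (ler_normD _ _))//.
by rewrite lerD ?opnorm_le.
Qed.

Let bop_normZ_le (a : R[i]) T : bop_norm (a *: T) <= `|a| * bop_norm T.
Proof.
rewrite abs_Re /bop_norm -rmorphM lecR opnorm_le_bound//.
  by rewrite mulr_ge0// -lecR -abs_Re normr_ge0.
move=> x; rewrite rmorphM /= -abs_Re.
by rewrite [X in `|X|](_ : _ = a *: T x)// normrZ -mulrA ler_wpM2l ?opnorm_le.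
Qed.

Let bop_normZ (a : R[i]) T : bop_norm (a *: T) = `|a| * bop_norm T.
Proof.
apply/eqP; rewrite eq_le bop_normZ_le/=.
have [->|a0] := eqVneq a 0.
  by rewrite normr0 mul0r /bop_norm lecR.
rewrite -[in leLHS](scalerK a0 T) -ler_pdivlMl ?normr_gt0// -normfV.
exact: bop_normZ_le.
Qed.

Let bop_norm_eq0 T : bop_norm T = 0 -> T = 0.
Proof.
rewrite /bop_norm => T0; apply/val_inj/funext => x /=.
by apply/eqP; rewrite -normr_le0 (le_trans (opnorm_le T x))// T0 mul0r.
Qed.

HB.instance Definition _ := Lmodule_isNormed.Build R[i] bounded_operator
  bop_normD bop_normZ bop_norm_eq0.

Lemma bop_normE (T : bounded_operator) : `|T| = (opnorm T)%:C.
Proof. by []. Qed.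

End BoundedOperators.

Arguments bounded_operator {R} H.
Arguments bop_id {R} H.

Definition complete_circular_domain (R : realType) (n : nat)
    (Q : set 'rV[R[i]]_n) : Prop :=
  [/\ open Q, connected Q, Q 0
    & forall (z : 'rV[R[i]]_n) (xi : R[i]), Q z -> `|xi| <= 1 -> Q (xi *: z)].

Definition homothetic (R : realType) (n : nat) (rho : R)
    (Q : set 'rV[R[i]]_n) : set 'rV[R[i]]_n :=
  [set rho%:C *: z | z in Q].

(* P_k(z) = \sum_(|alpha| = k) z^alpha A_alpha.  A multi-index of length k has
   all its entries at most k, so the sum ranges over the finite type of maps
   'I_n -> 'I_k.+1. *)
Definition homogeneous_part (R : realType) (n : nat) (H : normedModType R[i])
    (A : {ffun 'I_n -> nat} -> bounded_operator H) (k : nat)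
    (z : 'rV[R[i]]_n) : bounded_operator H :=
  \sum_(a : {ffun 'I_n -> 'I_k.+1} | (\sum_i a i)%N == k)
    (\prod_i z ord0 i ^+ a i) *: A [ffun i => val (a i)].

(* Admissible functions of the Bohr inequality; the values of f outside Q are
   irrelevant. *)
Definition bohr_function (R : realType) (n : nat) (H : normedModType R[i])
    (Q : set 'rV[R[i]]_n) (f : 'rV[R[i]]_n -> bounded_operator H)
    (A : {ffun 'I_n -> nat} -> bounded_operator H) (a0 : R[i]) : Prop :=
  [/\ forall z, Q z ->
        series (fun k => homogeneous_part A k z) @ \oo --> f z,
      forall z, Q z -> `|f z| < 1,
      f 0 = a0 *: bop_id H
    & `|a0| < 1].

(* Equal to +oo when the series diverges. *)
Definition majorant_sum (R : realType) (n : nat) (H : normedModType R[i])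
    (A : {ffun 'I_n -> nat} -> bounded_operator H)
    (z : 'rV[R[i]]_n) : \bar R :=
  (\sum_(0 <= k <oo) (opnorm (homogeneous_part A k z))%:E)%E.

(* Main.v *)
Require Import Defs.
From HB Require Import structures.
From mathcomp Require Import all_boot all_order all_algebra sesquilinear.
From mathcomp Require Import complex.
From mathcomp Require Import all_classical all_reals all_analysis.
From mathcomp Require Import ring lra.
Import Order.TTheory GRing.Theory Num.Theory.
Import numFieldNormedType.Exports.
Local Open Scope classical_set_scope.
Local Open Scope ring_scope.
Local Open Scope complex_scope.

(* Restricting f to the disc through z in Q gives g(xi) = sum_k xi^k P_k(z) with
   ||g|| <= 1.  Parseval over roots of unity, applied to g(r xi)(x + xi^k y) with
   r < 1, yields |a0 x|^2 + |r^k P_k(z) x + a0 y|^2 <= |x|^2 + |y|^2; a suitable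
   y and r -> 1 give ||P_k(z)|| <= 1 - |a0|^2 for k >= 1, so that at z / 3 the
   majorant is at most |a0| + (1 - |a0|^2) / 2 < 1.

   For sharpness, a convex Q <> C^n has a nonzero linear form l bounded on Q,
   normalised by sup_Q |l| = 1.  The functions (a - l) / (1 - a l) I have majorant
   a + (1 - a^2) |l| / (1 - a |l|), which exceeds 1 once |l| > 1 / (1 + 2 a). *)

Set Implicit Arguments.
Unset Strict Implicit.
Unset Printing Implicit Defensive.

(** * Parseval's identity and Wiener's coefficient bound *)

(** X^N - 1 is separable in characteristic 0, hence has N distinct roots; one of them generates the
    group of N-th roots of unity. *)
Lemma exists_prim_root (F : numClosedFieldType) (N : nat) :
  (0 < N)%N -> exists w : F, N.-primitive_root w.
Proof.
move=> N_gt0; have [r] := closed_field_poly_normal ('X^N - 1 : {poly F}).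
rewrite (monicP _) ?monicXnsubC// scale1r => Dp.
have rN1 : all N.-unity_root r by apply/allP => z; rewrite -root_prod_XsubC -Dp.
have sz_r : (N < (size r).+1)%N.
  by rewrite -(size_prod_XsubC r id) -Dp size_XnsubC.
have [|w _ ?] := hasP (cyclic.has_prim_root N_gt0 rN1 _ sz_r); last by exists w.
rewrite -separable.separable_prod_XsubC -Dp cyclotomic.separable_Xn_sub_1//.
by rewrite pnatr_eq0 -lt0n.
Qed.

Lemma normr_prim_root (F : numClosedFieldType) (N : nat) (w : F) :
  N.-primitive_root w -> `|w| = 1.
Proof.
move=> wN; apply/eqP; rewrite -(@pexpr_eq1 _ _ N) ?(prim_order_gt0 wN)//.
by rewrite -normrX (prim_expr_order wN) normr1.
Qed.

(** Orthogonality of characters: the conjugate of w is its inverse, so for m <> p the sum is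
    geometric, with ratio an N-th root of unity other than 1, and vanishes. *)
Lemma sum_prim_root_conj (F : numClosedFieldType) (N : nat) (w : F) (m p : 'I_N) :
  N.-primitive_root w ->
  \sum_(j < N) w ^+ (j * m) * (w ^+ (j * p))^*%R = (N * (m == p))%:R.
Proof.
move=> wN; have w1 := normr_prim_root wN.
have wX1 a : w ^+ a * (w ^+ a)^*%R = 1 by rewrite -normCK normrX w1 !expr1n.
have [->|mp] := eqVneq m p.
  under eq_bigr do rewrite wX1.
  by rewrite sumr_const card_ord muln1.
rewrite muln0; pose q := w ^+ m * (w ^+ p)^*%R.
have q1 : q != 1.
  apply: contra mp => /eqP q1; rewrite -val_eqE /=.
  rewrite -(modn_small (ltn_ord m)) -(modn_small (ltn_ord p)).
  rewrite -(eq_prim_root_expr wN); apply/eqP.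
  by rewrite -[RHS]mul1r -q1 /q -mulrA [X in _ * X]mulrC wX1 mulr1.
have qN : q ^+ N = 1.
  rewrite /q exprMn -rmorphXn -!exprM mulnC exprM (mulnC p) exprM.
  by rewrite (prim_expr_order wN) !expr1n rmorph1 mulr1.
have Eq (j : 'I_N) : w ^+ (j * m) * (w ^+ (j * p))^*%R = q ^+ j.
  by rewrite /q exprMn -rmorphXn -!exprM ![(_ * j)%N]mulnC.
under eq_bigr do rewrite Eq.
apply: (mulfI (_ : q - 1 != 0)); first by rewrite subr_eq0.
by rewrite -subrX1 qN subrr mulr0.
Qed.

(** Summation over the N-th roots of unity replaces integration over the circle; after expanding the
    inner products, orthogonality leaves only the diagonal. *)
Lemma parseval_prim_root (R : realType) (H : completeNormedModType R[i])
    (dot : {dot H for Num.conj}) (Hdot : hilbert_product dot)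
    (N : nat) (w : R[i]) (c : 'I_N -> H) : N.-primitive_root w ->
  \sum_(j < N) `|\sum_(m < N) w ^+ (j * m) *: c m| ^+ 2 =
  N%:R * \sum_(m < N) `|c m| ^+ 2.
Proof.
move=> wN.
transitivity (\sum_(j < N) \sum_(m < N) \sum_(p < N)
    (w ^+ (j * m) * (w ^+ (j * p))^*%R) * dot (c m) (c p)).
  apply: eq_bigr => j _; rewrite Hdot linear_sumlz; apply: eq_bigr => m _.
  rewrite linear_sumr; apply: eq_bigr => p _.
  by rewrite linearZl_LR linearZr_LR/= mulrA.
rewrite exchange_big mulr_sumr; apply: eq_bigr => m _.
rewrite exchange_big /= (bigD1 m)//= [X in _ + X]big1 ?addr0.
  by rewrite -mulr_suml sum_prim_root_conj// eqxx muln1 Hdot.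
move=> p pm; rewrite -mulr_suml sum_prim_root_conj//.
by rewrite eq_sym (negbTE pm) muln0 mul0r.
Qed.

Section BoundedOperatorTheory.
Context {R : realType} {H : normedModType R[i]}.
Implicit Types (S T : bounded_operator H) (x y : H).

Lemma bop_sumE I (r : seq I) (P : pred I) (F : I -> bounded_operator H) x :
  (\sum_(i <- r | P i) F i) x = \sum_(i <- r | P i) F i x.
Proof. exact: (big_morph (fun T : bounded_operator H => T x)). Qed.

Lemma bop_linear T : linear T.
Proof. by have /bounded_linearP[] := bop_funP T. Qed.

Lemma bopDr T x y : T (x + y) = T x + T y.
Proof. by have := bop_linear T 1 x y; rewrite !scale1r. Qed.

Lemma bopZr T a x : T (a *: x) = a *: T x.
Proof.
have T0 : T 0 = 0 by apply: (addrI (T 0)); rewrite -bopDr !addr0.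
by have := bop_linear T a x 0; rewrite T0 !addr0.
Qed.

Lemma opnorm_ge0 T : 0 <= opnorm T.
Proof. by rewrite -lecR -bop_normE normr_ge0. Qed.

Lemma le_normr_bop T x : `|T x| <= `|T| * `|x|.
Proof. by rewrite bop_normE opnorm_le. Qed.

Lemma normr_bop_le T (c : R[i]) :
  0 <= c -> (forall x, `|T x| <= c * `|x|) -> `|T| <= c.
Proof.
move=> c0 hc; have /complex_realP[r cE] := ger0_real c0.
rewrite cE bop_normE lecR; apply: opnorm_le_bound.
  by rewrite -lecR -cE.
by move=> x; rewrite -cE.
Qed.

End BoundedOperatorTheory.

(* Parseval applied to the polynomial (\sum_l xi^l B_l) (x + xi^k y), keeping
   only its coefficients of degrees 0 and k. *)
Lemma toeplitz_contraction (R : realType) (H : completeNormedModType R[i])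
    (dot : {dot H for Num.conj}) (Hdot : hilbert_product dot)
    (B : nat -> bounded_operator H) (M k : nat) (K : R[i]) (x y : H) :
  (0 < k < M)%N ->
  (forall xi : R[i], `|xi| = 1 -> `|\sum_(l < M) xi ^+ l *: B l| <= K) ->
  `|B 0%N x| ^+ 2 + `|B k x + B 0%N y| ^+ 2 <= K ^+ 2 * (`|x| ^+ 2 + `|y| ^+ 2).
Proof.
move=> /andP[k_gt0 kM] hK.
have K_ge0 : 0 <= K by rewrite (le_trans _ (hK 1 (normr1 _))).
(* The product polynomial has degree below M + k, so this many roots of unity separate its
   coefficients, listed by [c] below. *)
pose N := (M + k)%N.
have [w wN] : exists w : R[i], N.-primitive_root w.
  by apply: exists_prim_root; rewrite /N addn_gt0 k_gt0 orbT.
pose c (m : 'I_N) := (if (m < M)%N then B m x else 0) +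
                     (if (k <= m)%N then B (m - k)%N y else 0).
pose u (m : 'I_N) := (if m == 0%N :> nat then x else 0) +
                     (if m == k :> nat then y else 0).
have N_gt0 : (0 < N)%N by exact: prim_order_gt0 wN.
have kN : (k < N)%N by rewrite (leq_trans kM)// leq_addr.
pose i0 : 'I_N := Ordinal N_gt0; pose ik : 'I_N := Ordinal kN.
have i0k : ik != i0 by rewrite -val_eqE /= -lt0n.
have uE (xi : R[i]) : \sum_(m < N) xi ^+ m *: u m = x + xi ^+ k *: y.
  rewrite (bigD1 i0)//= (bigD1 ik)//= big1 ?addr0.
    by rewrite /u /= eqxx (negbTE (lt0n_neq0 k_gt0)) eq_sym
      (negbTE (lt0n_neq0 k_gt0)) addr0 add0r scale1r.
  move=> m /andP[m0 mk]; rewrite /u.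
  by rewrite (negbTE m0 : (m == 0%N :> nat) = false)
    (negbTE mk : (m == k :> nat) = false) addr0 scaler0.
have cE (xi : R[i]) : \sum_(m < N) xi ^+ m *: c m =
    (\sum_(l < M) xi ^+ l *: B l) (x + xi ^+ k *: y).
  rewrite bopDr bopZr !bop_sumE /c.
  under eq_bigr do rewrite scalerDr.
  rewrite big_split/=; congr (_ + _).
    rewrite [LHS]big_split_ord/= [X in _ + X]big1 ?addr0.
      by apply: eq_bigr => l _; rewrite ltn_ord.
    by move=> l _; rewrite ltnNge leq_addr /= scaler0.
  rewrite scaler_sumr -(big_mkord predT (fun m =>
    xi ^+ m *: (if (k <= m)%N then B (m - k)%N y else 0))) /=.
  rewrite (big_cat_nat (leq0n k)) ?leq_addl//= big_nat big1 ?add0r.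
    rewrite -{1}(add0n k) big_addn /N addnK big_mkord; apply: eq_bigr => l _.
    by rewrite leq_addl addnK addnC exprD -scalerA.
  by move=> l /andP[_ lk]; rewrite leqNgt lk/= scaler0.
have : \sum_(j < N) `|\sum_(m < N) w ^+ (j * m) *: c m| ^+ 2 <=
       K ^+ 2 * \sum_(j < N) `|\sum_(m < N) w ^+ (j * m) *: u m| ^+ 2.
  rewrite mulr_sumr; apply: ler_sum => j _.
  under eq_bigr do rewrite exprM.
  under [X in _ <= _ * `|X| ^+ 2]eq_bigr do rewrite exprM.
  rewrite cE uE -exprMn ler_sqr ?nnegrE ?mulr_ge0//.
  apply: (le_trans (le_normr_bop _ _)); rewrite ler_wpM2r// hK//.
  by rewrite normrX (normr_prim_root wN) expr1n.
rewrite !(parseval_prim_root Hdot)// mulrCA ler_pM2l ?ltr0n//.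
(* Here 0 < k < M matters: y does not enter degree 0, and the truncation at M keeps [B k x] in
   degree k. *)
have c0 : c i0 = B 0%N x.
  by rewrite /c /= (leq_ltn_trans (leq0n k) kM) leqNgt k_gt0 addr0.
have ck : c ik = B k x + B 0%N y by rewrite /c /= kM leqnn subnn.
have -> : \sum_(m < N) `|u m| ^+ 2 = `|x| ^+ 2 + `|y| ^+ 2.
  rewrite (bigD1 i0)//= (bigD1 ik)//= big1 ?addr0.
    by rewrite /u /= eqxx (negbTE (lt0n_neq0 k_gt0)) eq_sym
      (negbTE (lt0n_neq0 k_gt0)) addr0 add0r.
  move=> m /andP[m0 mk]; rewrite /u.
  by rewrite (negbTE m0 : (m == 0%N :> nat) = false)
    (negbTE mk : (m == k :> nat) = false) addr0 normr0 expr0n.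
apply: le_trans; rewrite -c0 -ck (bigD1 i0)//= (bigD1 ik)//= addrA lerDl.
by apply: sumr_ge0 => m _; rewrite exprn_ge0.
Qed.

Lemma exists_exprn_le (R : realType) (r e : R[i]) :
  0 <= r -> r < 1 -> 0 < e -> exists m, forall n, (m <= n)%N -> r ^+ n <= e.
Proof.
move=> r0 r1 e0.
have /complex_realP[s sE] := ger0_real r0.
have /complex_realP[d dE] := gtr0_real e0.
move: r0 r1 e0; rewrite {}sE {}dE lecR !ltcR => s0 s1 d0.
have s1' : `|s| < 1 by rewrite ger0_norm.
have /cvgrPdist_le/(_ _ d0)[m _ hm] := cvg_expr s1'.
exists m => n mn; rewrite -rmorphXn/= lecR.
by have := hm n mn; rewrite /= sub0r normrN ger0_norm// exprn_ge0.
Qed.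

Lemma norm_geometric_tail_le (F : numFieldType) (V : normedModType F)
    (v : nat -> V) (r : F) (m n : nat) : 0 <= r -> r < 1 ->
  (forall l, (m <= l)%N -> `|v l| <= r ^+ l) ->
  `|\sum_(m <= l < n) v l| <= r ^+ m / (1 - r).
Proof.
move=> r0 r1 hv; have r1' : 0 < 1 - r by rewrite subr_gt0.
have [mn|/ltnW nm] := leqP m n; last first.
  by rewrite big_geq// normr0 divr_ge0 ?exprn_ge0// ltW.
apply: (le_trans (ler_norm_sum _ _ _)).
apply: (@le_trans _ _ (\sum_(m <= l < n) r ^+ l)).
  by rewrite ler_sum_nat// => l /andP[ml _]; exact: hv.
rewrite ler_pdivlMr// -(subnKC mn) geometric_partial_tail.
rewrite geometric_seriesE ?lt_eqF//= divfK ?gt_eqF//.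
by rewrite mulrBr mulr1 lerBlDr lerDl mulr_ge0 ?exprn_ge0.
Qed.

Section Wiener.
Variables (R : realType) (H : completeNormedModType R[i]).
Variables (dot : {dot H for Num.conj}) (Hdot : hilbert_product dot).
Implicit Types (a xi : R[i]) (T : bounded_operator H).

(** The hypothesis says that the block operator with rows (a, 0) and (T, a) is a contraction. *)
Lemma contraction_coef_bound a T : `|a| < 1 ->
  (forall x y, `|a *: x| ^+ 2 + `|T x + a *: y| ^+ 2 <= `|x| ^+ 2 + `|y| ^+ 2) ->
  `|T| <= 1 - `|a| ^+ 2.
Proof.
move=> a1 hT; set d := 1 - _.
have d0 : 0 < d by rewrite subr_gt0 expr_lt1.
have d_neq0 : d != 0 by rewrite gt_eqF.
apply: normr_bop_le => [|x]; first exact: ltW.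
(* This y maximises |T x + a y|^2 - |y|^2; it turns T x + a y into T x / d, and the inequality
   reduces to |T x / d| <= |x|. *)
have /= := hT x ((a^*%R / d) *: T x).
have -> : T x + a *: ((a^*%R / d) *: T x) = d^-1 *: T x.
  rewrite scalerA mulrA -normCK -[X in X + _]scale1r -scalerDl; congr (_ *: _).
  by apply: (mulIf d_neq0); rewrite mulrDl divfK// mulVf// mul1r subrK.
rewrite !normrZ normfV norm_conjC (gtr0_norm d0) => hx.
rewrite -ler_sqr ?nnegrE ?mulr_ge0 ?(ltW d0)//.
have {}hx : d * (d^-1 * `|T x|) ^+ 2 <= d * `|x| ^+ 2.
  rewrite -subr_ge0 [X in 0 <= X](_ : _ = `|x| ^+ 2 + (`|a| / d * `|T x|) ^+ 2 -
    ((`|a| * `|x|) ^+ 2 + (d^-1 * `|T x|) ^+ 2)) ?subr_ge0//.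
  by move: (d^-1) => c; rewrite /d; ring.
move: hx; rewrite ler_pM2l// exprMn exprVn ler_pdivrMl ?exprn_gt0//.
by rewrite exprMn.
Qed.

Lemma wiener_bound (P : nat -> bounded_operator H) a : `|a| < 1 ->
  P 0%N = a *: bop_id H ->
  (forall xi, `|xi| <= 1 -> exists2 g : bounded_operator H,
    series (fun k => xi ^+ k *: P k) @ \oo --> g & `|g| <= 1) ->
  forall k, (0 < k)%N -> `|P k| <= 1 - `|a| ^+ 2.
Proof.
move=> a1 P0 hP k k_gt0; set d := 1 - _.
have d0 : 0 < d by rewrite subr_gt0 expr_lt1.
have [m hm] : exists m, forall l, (m <= l)%N -> `|P l| <= 1.
  have [|g cvg_g _] := hP 1; first by rewrite normr1.
  have cvg_S : cvgn (series (fun k => 1 ^+ k *: P k)) by apply/cvg_ex; exists g.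
  have /cvgr0Pnorm_le/(_ 1 ltr01)[m _ hm] := cvg_series_cvg_0 cvg_S.
  by exists m => l ml; have := hm l ml; rewrite /= expr1n scale1r.
(* Convergence in xi is only pointwise. The factors r^l with r < 1 make the tails uniformly small,
   so truncations are almost contractions on the circle. *)
have ball_bound (r : R[i]) : 0 <= r -> r < 1 -> `|r ^+ k *: P k| <= d.
  move=> r0 r1; apply: contraction_coef_bound => // x y.
  apply/ler_addgt0Pr => e e0; pose Z := `|x| ^+ 2 + `|y| ^+ 2.
  have Z0 : 0 <= Z by rewrite addr_ge0 ?exprn_ge0.
  (* Chosen so that c <= 1, whence (1 + c)^2 <= 1 + 3 c, and 3 c Z <= e; the summand e keeps the
     denominator positive when Z = 0. *)
  pose c := e / (3 * Z + e).
  have D0 : 0 < 3 * Z + e by rewrite ltr_wpDl// mulr_ge0.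
  have c0 : 0 < c by rewrite divr_gt0.
  have c1 : c <= 1 by rewrite ler_pdivrMr// mul1r lerDr mulr_ge0.
  have cZ : 3 * c * Z <= e.
    rewrite (_ : 3 * c * Z = e * (3 * Z / (3 * Z + e))); last first.
      by rewrite /c; move: (_^-1) => i; ring.
    by rewrite ler_piMr ?(ltW e0)// ler_pdivrMr// mul1r lerDl ltW.
  have r1' : 0 < 1 - r by rewrite subr_gt0.
  have [m1 hm1] : exists m, forall n, (m <= n)%N -> r ^+ n <= c / 2 * (1 - r).
    by apply: exists_exprn_le => //; rewrite mulr_gt0 ?divr_gt0.
  pose M := maxn k.+1 (maxn m m1).
  have bound xi : `|xi| = 1 ->
      `|\sum_(l < M) xi ^+ l *: (r ^+ l *: P l)| <= 1 + c.
    move=> xi1; have rxi : `|r * xi| = r by rewrite normrM xi1 mulr1 ger0_norm.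
    have [|g /cvgrPdist_le/(_ (c / 2)) cvg_g g1] := hP (r * xi).
      by rewrite rxi ltW.
    have [|n0 _ hn0] := cvg_g; first by rewrite divr_gt0.
    (* [n0] depends on xi, but the bound c / 2 on the block from M to n does not. *)
    pose n := maxn M n0.
    have Mn : (M <= n)%N by exact: leq_maxl.
    have -> : \sum_(l < M) xi ^+ l *: (r ^+ l *: P l) =
        g - (g - series (fun l => (r * xi) ^+ l *: P l) n) -
        \sum_(M <= l < n) (r * xi) ^+ l *: P l.
      rewrite subKr /series/= (big_cat_nat (leq0n M) Mn)/= addrK big_mkord.
      by apply: eq_bigr => l _; rewrite scalerA -exprMn mulrC.
    apply: (le_trans (ler_normB _ _)); rewrite [c in leRHS]splitr addrA lerD//.
      apply: (le_trans (ler_normB _ _)); rewrite lerD// hn0//=.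
      exact: leq_maxr.
    apply: (@le_trans _ _ (r ^+ M / (1 - r))).
      apply: norm_geometric_tail_le => // l Ml.
      rewrite normrZ normrX rxi ler_piMr ?exprn_ge0// hm//.
      by rewrite (leq_trans _ Ml)// /M !leq_max leqnn orbT.
    by rewrite ler_pdivrMr// hm1// /M !leq_max leqnn !orbT.
  have kM : (0 < k < M)%N by rewrite k_gt0 /M leq_maxl.
  have := toeplitz_contraction Hdot (B := fun l => r ^+ l *: P l) x y kM bound.
  rewrite expr0 scale1r P0 => /le_trans; apply.
  rewrite -/Z; apply: (@le_trans _ _ ((1 + 3 * c) * Z)); last first.
    by rewrite mulrDl mul1r lerD2l.
  rewrite ler_wpM2r//; rewrite -subr_ge0.
  have -> : 1 + 3 * c - (1 + c) ^+ 2 = c * (1 - c) by ring.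
  by rewrite mulr_ge0 ?subr_ge0// ltW.
(* Letting r tend to 1: if |P k| > d, some s lies strictly between d / |P k| and 1, and r = s^(1/k)
   contradicts [ball_bound]. *)
rewrite real_leNgt ?realE ?normr_ge0 ?(ltW d0)//; apply/negP => dP.
have P0' : 0 < `|P k| by exact: lt_trans dP.
pose q := d / `|P k|.
have q1 : q < 1 by rewrite ltr_pdivrMr// mul1r.
have q0 : 0 < q by rewrite divr_gt0.
pose s := (q + 1) / 2.
have [qs s1] := midf_lt q1; rewrite -/s in qs s1.
have s0 : 0 <= s by rewrite ltW// (lt_trans q0).
have := ball_bound (k.-root s); rewrite rootC_ge0// rootC_lt1// => /(_ s0 s1).
rewrite rootCK// normrZ (ger0_norm s0) -ler_pdivlMr// -/q => sq.
by have := lt_le_trans qs sq; rewrite ltxx.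
Qed.

End Wiener.

(** * The Bohr inequality *)

Section HomogeneousPart.
Context {R : realType} {n : nat} {H : normedModType R[i]}.
Implicit Types (A : {ffun 'I_n -> nat} -> bounded_operator H) (z : 'rV[R[i]]_n).

Lemma homogeneous_partZ A k (c : R[i]) z :
  homogeneous_part A k (c *: z) = c ^+ k *: homogeneous_part A k z.
Proof.
rewrite /homogeneous_part scaler_sumr; apply: eq_bigr => a /eqP ak.
rewrite scalerA; congr (_ *: _).
under eq_bigr do rewrite mxE exprMn.
by rewrite big_split/= prodrXr ak.
Qed.

Lemma opnormZ (c : R) (T : bounded_operator H) :
  0 <= c -> opnorm (c%:C *: T) = c * opnorm T.
Proof.
move=> c0; apply: complexI; rewrite rmorphM/= -!bop_normE normrZ.
by rewrite ger0_norm// lecR.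
Qed.

(** The part of degree 0 is constant in z, and at the origin every nonempty partial sum equals it,
    so it is the limit f 0. *)
Lemma bohr_function_part0 (Q : set 'rV[R[i]]_n) f A a0 z : Q 0 ->
  bohr_function Q f A a0 -> homogeneous_part A 0 z = a0 *: bop_id H.
Proof.
move=> Q0 [cvg_f _ <- _].
have <- : homogeneous_part A 0 0 = homogeneous_part A 0 z.
  by rewrite -(scale0r z) homogeneous_partZ expr0 scale1r.
apply: (cvg_unique (@norm_hausdorff _ _) _ (cvg_f _ Q0)) => /=.
apply/cvgrPdist_le => e e0; exists 1%N => // N/= N_gt0.
rewrite /series/= big_ltn// big_nat big1 ?addr0 ?subrr ?normr0 ?ltW//.
move=> k /andP[k_gt0 _]; rewrite -(scaler0 _ 0) homogeneous_partZ.
by rewrite expr0n (negbTE (lt0n_neq0 k_gt0)) scale0r.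
Qed.

End HomogeneousPart.

Lemma bohr_inequality (R : realType) (H : completeNormedModType R[i])
    (dot : {dot H for Num.conj}) (Hdot : hilbert_product dot)
    (n : nat) (Q : set 'rV[R[i]]_n) (HQ : complete_circular_domain Q)
    (f : 'rV[R[i]]_n -> bounded_operator H)
    (A : {ffun 'I_n -> nat} -> bounded_operator H) (a0 : R[i]) :
  bohr_function Q f A a0 ->
  forall z : 'rV[R[i]]_n, homothetic (3^-1) Q z -> (majorant_sum A z < 1)%E.
Proof.
move=> fA _ [z Qz <-]; have [_ _ Q0 QZ] := HQ.
have P0 := bohr_function_part0 z Q0 fA; have [cvg_f f_lt1 _ a0_lt1] := fA.
have PK : forall k, (0 < k)%N -> `|homogeneous_part A k z| <= 1 - `|a0| ^+ 2.
  apply: (wiener_bound Hdot (P := fun k => homogeneous_part A k z) a0_lt1 P0).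
  move=> xi xi1; have Qxz := QZ z xi Qz xi1.
  exists (f (xi *: z)); last exact/ltW/f_lt1.
  suff <- : (fun k => homogeneous_part A k (xi *: z)) =
      (fun k => xi ^+ k *: homogeneous_part A k z) by exact: cvg_f.
  by apply/funext => k; rewrite homogeneous_partZ.
have /complex_realP[al alE] := normr_real a0.
have al0 : 0 <= al by rewrite -lecR -alE normr_ge0.
have al1 : al < 1 by rewrite -ltcR -alE.
have {}P0 : opnorm (homogeneous_part A 0 z) <= al.
  rewrite -lecR -bop_normE -alE P0; apply: normr_bop_le => // x.
  by rewrite [X in `|X|](_ : _ = a0 *: x)// normrZ.
have {}PK k : (0 < k)%N -> opnorm (homogeneous_part A k z) <= 1 - al ^+ 2.
  by move=> k0; rewrite -lecR -bop_normE rmorphB rmorphXn/= -alE PK.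
(* The last factor comes from 3^-1 + ... + 3^-N = (1 - 3^-N) / 2. *)
have sum_le N : \sum_(k < N.+1) opnorm (homogeneous_part A k ((3^-1)%:C *: z)) <=
    al + (1 - al ^+ 2) / 2 * (1 - 3^-1 ^+ N).
  elim: N => [|N IH].
    by rewrite big_ord1 homogeneous_partZ expr0 scale1r subrr mulr0 addr0.
  rewrite big_ord_recr/= homogeneous_partZ -rmorphXn opnormZ ?exprn_ge0//.
  apply: (le_trans (lerD IH (ler_wpM2l _ (PK N.+1 isT)))); first exact: exprn_ge0.
  rewrite ![_ ^+ N.+1]exprS; move: (3^-1 ^+ N) => q.
  by rewrite le_eqVlt; apply/orP; left; apply/eqP; field.
(* Comparison with the limit value keeps the inequality strict: its distance to 1 is (1 - al)^2 /
   2. *)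
apply: (@le_lt_trans _ _ (al + (1 - al ^+ 2) / 2)%:E); last first.
  by rewrite lte_fin; nra.
apply: lime_le.
  by apply: is_cvg_nneseries => k _ _; rewrite lee_fin opnorm_ge0.
exists 1%N => // -[//|N] _ /=.
rewrite big_mkord sumEFin lee_fin (le_trans (sum_le N))// lerD2l.
rewrite ler_piMr ?gerBl ?exprn_ge0// divr_ge0// subr_ge0.
by rewrite exprn_ile1// ltW.
Qed.

(** * Linear forms bounded on a convex circular domain *)

Lemma normr_ReE (R : realType) (V : normedModType R[i]) (x : V) :
  `|x| = (complex.Re `|x|)%:C.
Proof. by have /complex_realP[k ->] := normr_real x. Qed.

Lemma normc_real (R : rcfType) (x : R) : `|x%:C| = `|x|%:C.
Proof. by rewrite normc_def/= expr0n addr0 sqrtr_sqr. Qed.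

Lemma normci (R : rcfType) : `|'i%C : R[i]| = 1.
Proof. by rewrite normc_def/= expr0n add0r expr1n sqrtr1. Qed.

(** Helly's theorem on the line: p stands for the interval of centre p.1 and radius p.2, and the
    supremum of the left ends lies in every interval. *)
Lemma intervals_common_point (R : realType) (S : set (R * R)) :
  S !=set0 ->
  (forall p q, S p -> S q -> p.1 - q.1 <= p.2 + q.2) ->
  exists al, forall p, S p -> `|p.1 - al| <= p.2.
Proof.
move=> [p0 Sp0] hS; pose L := [set p.1 - p.2 | p in S].
have ubL q : S q -> ubound L (q.1 + q.2).
  move=> Sq _ [p Sp <-]; have := hS p q Sp Sq; lra.
exists (sup L) => p Sp; rewrite ler_distlC; apply/andP; split.
- apply: ub_le_sup; first by exists (p0.1 + p0.2); exact: ubL.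
  by exists p.
- apply: ge_sup; first by exists (p0.1 - p0.2), p0.
  exact: ubL.
Qed.

(* The constant 2 is not optimal; it is what makes working on the real and
   imaginary parts separately sufficient. *)
Lemma discs_common_point (R : realType) (S : set (R[i] * R)) :
  S !=set0 ->
  (forall p q, S p -> S q -> `|p.1 - q.1| <= (p.2 + q.2)%:C) ->
  exists al : R[i], forall p, S p -> `|p.1 - al| <= (2 * p.2)%:C.
Proof.
move=> [p0 Sp0] hS.
(* [h] is the real or the imaginary part; it does not increase moduli, so the projected intervals
   still meet pairwise. *)
have part (h : {additive R[i] -> R}) : (forall z, `|h z|%:C <= `|z|) ->
    exists al, forall p, S p -> `|h p.1 - al| <= p.2.
  move=> hh; have [||al hal] :=
    @intervals_common_point R [set (h p.1, p.2) | p in S].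
  - by exists (h p0.1, p0.2), p0.
  - move=> _ _ [p Sp <-] [q Sq <-] /=; rewrite -raddfB -lecR.
    apply: le_trans (hS p q Sp Sq); apply: le_trans (hh _).
    by rewrite lecR ler_norm.
  - by exists al => p Sp; apply: (hal (h p.1, p.2)); exists p.
have [|re hre] := part (@complex.Re R); first exact: normc_ge_Re.
have [|im him] := part (@complex.Im R).
  move=> z /=; rewrite -[complex.Im z]opprK -ReiNIm normrN.
  by apply: le_trans (normc_ge_Re _) _; rewrite normrM normci mulr1.
exists (re +i* im) => p Sp.
have -> : p.1 - (re +i* im) =
    (complex.Re p.1 - re)%:C + 'i%C * (complex.Im p.1 - im)%:C.
  by rewrite [LHS]complexE !raddfB.
apply: (le_trans (ler_normD _ _)).
rewrite normrM normci mul1r mulr_natl mulr2n [leRHS]rmorphD lerD//.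
  by rewrite normc_real lecR hre.
by rewrite normc_real lecR him.
Qed.

Section ConvexCircular.
Variables (R : realType) (n : nat) (Q : set 'rV[R[i]]_n).
Hypotheses (HQ : complete_circular_domain Q) (Qconvex : convex_set Q).
Implicit Types (x y z : 'rV[R[i]]_n) (r s : R) (c : R[i]).

(** Subadditivity of the gauge of Q, from the convex combination with weights r / (r + s) and s / (r
    + s). *)
Lemma homotheticD r s x y : 0 < r -> 0 < s ->
  homothetic r Q x -> homothetic s Q y -> homothetic (r + s) Q (x + y).
Proof.
move=> r0 s0 [p Qp <-] [q Qq <-]; have rs0 : 0 < r + s by exact: addr_gt0.
have t0 : 0 <= (r / (r + s))%:C by rewrite lecR divr_ge0 ?ltW.
have t1 : (r / (r + s))%:C <= 1 by rewrite lecR ler_pdivrMr// mul1r lerDl ltW.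
pose t : {i01 R[i]} := Itv01 t0 t1.
have := @Qconvex p q t; rewrite !inE => /(_ Qp Qq) Qpq.
exists ((r / (r + s))%:C *: p + (1 - (r / (r + s))%:C) *: q) => //.
rewrite scalerDr !scalerA mulrBr mulr1 -!rmorphM -rmorphB/= mulrC divfK ?gt_eqF//.
by rewrite [r + s]addrC addrK.
Qed.

Lemma homotheticZ r c x :
  homothetic r Q x -> homothetic (complex.Re `|c| * r) Q (c *: x).
Proof.
move=> [q Qq <-]; have [_ _ Q0 QZ] := HQ.
(* Circularity absorbs the unimodular factor; for c = 0 the quotient is 0 and the witness is the
   origin. *)
exists ((c / `|c|) *: q).
  apply: QZ => //; rewrite normrM normfV normr_id.
  by have [->|c0] := eqVneq c 0; rewrite ?normr0 ?mul0r// divff// normr_eq0.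
rewrite !scalerA rmorphM/= -(@normr_ReE _ R[i]); congr (_ *: _).
have [->|c0] := eqVneq c 0; first by rewrite !mul0r mulr0.
by rewrite mulrAC mulrCA divff ?normr_eq0// mulr1 mulrC.
Qed.

Lemma homothetic_absorbs x : exists2 r, 0 < r & homothetic r Q x.
Proof.
have [oQ _ Q0 _] := HQ.
have /nbhs_ballP[e /= e0 he] := open_nbhs_nbhs (conj oQ Q0).
have /complex_realP[d dE] := gtr0_real e0.
have d0 : 0 < d by rewrite -ltcR -dE.
pose m := complex.Re `|x|; have m0 : 0 <= m by rewrite -lecR -normr_ReE normr_ge0.
(* The ball of radius d about 0 lies in Q; the added 1 gives a positive factor at x = 0 and strict
   membership in the ball. *)
exists ((m + 1) / d); first by rewrite divr_gt0// ltr_wpDl.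
have k0 : (((m + 1) / d)%:C : R[i]) != 0.
  by rewrite gt_eqF// ltcR divr_gt0// ltr_wpDl.
exists ((((m + 1) / d)%:C)^-1 *: x); last by rewrite scalerA divff// scale1r.
apply: he; rewrite -ball_normE/= sub0r normrN normrZ normfV.
rewrite (normr_ReE x) -/m.
rewrite normc_real -fmorphV/= -rmorphM/= dE ltcR.
rewrite ger0_norm ?divr_ge0 ?addr_ge0// ?ltW//.
by rewrite ltr_pdivrMl ?divfK ?gt_eqF ?ltrDl// divr_gt0// ltr_wpDl.
Qed.

(** Q being open, (1 + t) x is still in Q for some t > 0; this later makes the bound by a supremum
    over Q strict. *)
Lemma homothetic_shrink x : Q x -> exists2 r, 0 < r < 1 & homothetic r Q x.
Proof.
have [oQ _ _ _] := HQ => Qx.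
have /nbhs_ballP[e /= e0 he] := open_nbhs_nbhs (conj oQ Qx).
have /complex_realP[d dE] := gtr0_real e0.
have d0 : 0 < d by rewrite -ltcR -dE.
pose m := complex.Re `|x|; have m0 : 0 <= m by rewrite -lecR -normr_ReE normr_ge0.
pose t := d / (m + 1).
have t0 : 0 < t by rewrite divr_gt0// ltr_wpDl.
have t1 : 0 < 1 + t by rewrite addr_gt0.
exists (1 + t)^-1; first by rewrite invr_gt0 t1 invf_lt1// ltrDl.
exists ((1 + t)%:C *: x); last first.
  by rewrite scalerA -rmorphM mulVf ?gt_eqF// scale1r.
apply: he; rewrite -ball_normE/= rmorphD scalerDl scale1r opprD addNKr normrN normrZ.
rewrite (normr_ReE x) -/m normc_real -rmorphM/= dE ltcR gtr0_norm//.
by rewrite /t mulrAC ltr_pdivrMr ?ltr_wpDl// ltr_pM2l// ltrDl.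
Qed.
(* Crude Hahn-Banach: a functional is extended one vector at a time, the bound
   K on Q doubling at each step.  Functionals are given by their values c on the
   family b, which need not be free. *)
Lemma bounded_coefficients (b : nat -> 'rV[R[i]]_n) (k : nat) : ~ Q (b 0%N) ->
  exists (c : nat -> R[i]) (K : R), [/\ c 0%N = 1, 0 <= K &
    forall (t : nat -> R[i]) r, 0 < r ->
      homothetic r Q (\sum_(i < k.+1) t i *: b i) ->
      `|\sum_(i < k.+1) t i * c i| <= (K * r)%:C].
Proof.
move=> Qb0; have [_ _ _ QZ] := HQ.
elim: k => [|k [c [K [c0 K0 hK]]]].
  exists (fun=> 1), 1; split=> // t r r0; rewrite !big_ord1 mulr1 mul1r.
  move=> [q Qq qE]; rewrite real_leNgt ?normr_real ?ger0_real ?lecR ?(ltW r0)//.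
  (* If |t 0| > r, then b 0 = (r / t 0) q would lie in Q by circularity. *)
  apply/negP => rt; have r0' : 0 < (r%:C : R[i]) by rewrite ltcR.
  have t0 : t 0%N != 0 by rewrite -normr_gt0 (lt_trans r0').
  apply: Qb0; have -> : b 0%N = ((t 0%N)^-1 * r%:C) *: q.
    by rewrite -scalerA qE scalerA mulVf// scale1r.
  apply: QZ => //; rewrite normrM normfV ler_pdivrMl ?normr_gt0// mulr1.
  by rewrite gtr0_norm// ltW.
pose v (t : nat -> R[i]) := \sum_(i < k.+1) t i *: b i.
pose l (t : nat -> R[i]) := \sum_(i < k.+1) t i * c i.
(* Each p is a disc that constrains the new value: whenever v t - b_(k+1) lies in r Q, that value
   has to be close to l t, on the scale K r. *)
pose S := [set p : R[i] * R | exists t r,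
  [/\ 0 < r, homothetic r Q (v t - b k.+1) & p = (l t, K * r)]].
have [||al hal] := @discs_common_point R S.
- have [r r0 hr] := homothetic_absorbs (v (fun=> 0) - b k.+1).
  by exists (l (fun=> 0), K * r), (fun=> 0), r.
(* Subtracting two such vectors eliminates [b k.+1], so the induction hypothesis bounds the distance
   between the centres. *)
- move=> _ _ [t [r [r0 hr ->]]] [t' [r' [r'0 hr' ->]]] /=.
  pose u i := t i - t' i.
  have -> : l t - l t' = l u.
    by rewrite /l -sumrB; apply: eq_bigr => i _; rewrite mulrBl.
  rewrite -mulrDr; apply: hK; first exact: addr_gt0.
  have -> : \sum_(i < k.+1) u i *: b i = (v t - b k.+1) + (-1) *: (v t' - b k.+1).
    rewrite scaleN1r opprB addrA subrK /v -sumrB.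
    by apply: eq_bigr => i _; rewrite scalerBl.
  apply: homotheticD => //; have := homotheticZ (-1) hr'.
  by rewrite normrN1 /= mul1r.
exists (fun i => if i == k.+1 then al else c i), (2 * K); split=> //.
  by rewrite mulr_ge0.
move=> t r r0; rewrite big_ord_recr [X in _ -> `|X| <= _]big_ord_recr/= eqxx -/(v t).
rewrite [X in `|X + _|](_ : _ = l t); last first.
  by apply: eq_bigr => i _; rewrite (ltn_eqF (ltn_ord i)).
have [->|t0] := eqVneq (t k.+1) 0.
  rewrite scale0r mul0r !addr0 => /(hK t r r0) /le_trans; apply.
  by rewrite lecR ler_wpM2r ?(ltW r0)// ler_peMl// ler1n.
have nt0 : 0 < complex.Re `|t k.+1| by rewrite -ltcR -normr_ReE normr_gt0.
(* Division by - t_(k+1) normalises the coefficient of [b k.+1] to -1, the shape used in [S]. *)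
move=> /(homotheticZ (- (t k.+1)^-1)).
pose u i := - (t k.+1)^-1 * t i.
have -> : - (t k.+1)^-1 *: (v t + t k.+1 *: b k.+1) = v u - b k.+1.
  rewrite scalerDr scalerA mulNr mulVf// scaleN1r /v scaler_sumr; congr (_ - _).
  by apply: eq_bigr => i _; rewrite scalerA.
pose s := complex.Re `|- (t k.+1)^-1| * r; rewrite -/s => hs.
have sE : s = r / complex.Re `|t k.+1|.
  by rewrite /s mulrC normrN normfV (normr_ReE (t k.+1)) -fmorphV.
have {}hal : `|l u - al| <= (2 * (K * s))%:C.
  by apply: (hal (l u, K * s)); exists u, s; split=> //; rewrite sE divr_gt0.
have -> : l t + t k.+1 * al = - t k.+1 * (l u - al).
  have -> : l u = - (t k.+1)^-1 * l t.
    by rewrite /l mulr_sumr; apply: eq_bigr => i _; rewrite mulrA.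
  by rewrite mulrBr mulrA mulrNN divff// mul1r mulNr opprK.
rewrite normrM normrN; apply: (le_trans (ler_wpM2l (normr_ge0 _) hal)).
rewrite (normr_ReE (t k.+1)) -rmorphM lecR sE.
by rewrite le_eqVlt; apply/orP; left; apply/eqP; field; rewrite gt_eqF.
Qed.

End ConvexCircular.

Section NormingFunctional.
Variables (R : realType) (n : nat) (Q : set 'rV[R[i]]_n).
Hypotheses (HQ : complete_circular_domain Q) (Qconvex : convex_set Q).

Definition linear_form (lam : 'I_n -> R[i]) (z : 'rV[R[i]]_n) : R[i] :=
  \sum_i lam i * z ord0 i.

Lemma linear_formZ lam c z : linear_form lam (c *: z) = c * linear_form lam z.
Proof.
by rewrite /linear_form mulr_sumr; apply: eq_bigr => i _; rewrite mxE mulrCA.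
Qed.

Lemma exists_bounded_linear_form : Q != setT ->
  exists (lam : 'I_n -> R[i]) (K : R),
    (forall z, Q z -> `|linear_form lam z| <= K%:C) /\
    exists2 z, Q z & linear_form lam z != 0.
Proof.
move=> /eqP QT; have [_ _ Q0 _] := HQ.
have [w Qw] : exists w, ~ Q w.
  by apply/existsNP => Qall; apply: QT; apply/seteqP; split.
(* The vector w followed by the standard basis; the values found on the basis define the form. *)
pose b j := if j is j'.+1 then
  oapp (fun i : 'I_n => delta_mx ord0 i : 'rV[R[i]]_n) 0 (insub j') else w.
have [c [K [c0 K0 hK]]] := @bounded_coefficients R n Q HQ Qconvex b n Qw.
pose lam (i : 'I_n) := c i.+1.
have {}hK a z r : 0 < r -> homothetic r Q (a *: w + z) ->
    `|a + linear_form lam z| <= (K * r)%:C.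
  move=> r0; pose t j := if j is j'.+1 then oapp (z ord0) 0 (insub j') else a.
  have := hK t r r0; rewrite !big_ord_recl /= c0 mulr1.
  have -> : \sum_(i < n) t (bump 0 i) *: b (bump 0 i) = z.
    by rewrite [RHS]row_sum_delta; apply: eq_bigr => i _; rewrite /= !valK.
  have -> : \sum_(i < n) t (bump 0 i) * c (bump 0 i) = linear_form lam z; last by [].
  by apply: eq_bigr => i _; rewrite /= !valK mulrC.
exists lam, K; split=> [z Qz|].
  have := hK 0 z 1 ltr01; rewrite scale0r !add0r mulr1; apply.
  by exists z => //; rewrite scale1r.
(* 0 = w - w lies in r Q for every r > 0, so |1 - l(w)| <= K r: the values assigned to the dependent
   family are consistent. *)
have lw1 : linear_form lam w = 1.
  apply/eqP; rewrite -subr_eq0 -normr_le0 -normrN opprB; apply/ler_addgt0Pl => e e0.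
  have /complex_realP[d dE] := gtr0_real e0.
  have d0 : 0 < d by rewrite -ltcR -dE.
  have K1 : 0 < K + 1 by rewrite ltr_wpDl.
  have dK0 : 0 < d / (K + 1) by rewrite divr_gt0.
  rewrite addr0 -[- _]mulN1r -linear_formZ.
  apply: le_trans (hK 1 _ _ dK0 _) _.
    by rewrite scale1r scaleN1r subrr; exists 0; rewrite ?scaler0.
  by rewrite dE lecR mulrCA ler_piMr ?(ltW d0)// ler_pdivrMr// mul1r lerDl ler01.
have [r r0 [q Qq qE]] := homothetic_absorbs HQ w.
exists q => //; apply/eqP => lq0; have /eqP := lw1.
by rewrite -qE linear_formZ lq0 mulr0 eq_sym oner_eq0.
Qed.

(** The bounded form is divided by the supremum of its modulus over Q, which is positive and, Q
    being open, not attained. *)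
Lemma exists_norming_linear_form : Q != setT ->
  exists lam : 'I_n -> R[i],
    (forall z, Q z -> `|linear_form lam z| < 1) /\
    forall s : R, s < 1 -> exists2 z, Q z & s%:C < `|linear_form lam z|.
Proof.
move=> /exists_bounded_linear_form[lam [K [hK [z0 Qz0 lz0]]]].
pose L := [set complex.Re `|linear_form lam z| | z in Q].
have supL : has_sup L.
  split; first by exists (complex.Re `|linear_form lam z0|), z0.
  by exists K => _ [z Qz <-]; rewrite -lecR -(@normr_ReE _ R[i]) hK.
have leM z : Q z -> `|linear_form lam z| <= (sup L)%:C.
  move=> Qz; rewrite (@normr_ReE _ R[i]) lecR.
  by apply: ub_le_sup; [case: supL | exists z].
have M0 : 0 < sup L.
  by rewrite -ltcR (lt_le_trans _ (leM _ Qz0))// normr_gt0.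
have ltM z : Q z -> `|linear_form lam z| < (sup L)%:C.
  move=> Qz; have [r /andP[r0 r1] [q Qq <-]] := homothetic_shrink HQ Qz.
  rewrite linear_formZ normrM normc_real (gtr0_norm r0).
  apply: (@le_lt_trans _ _ (r%:C * (sup L)%:C)).
    by rewrite ler_wpM2l ?leM// lecR ltW.
  by rewrite gtr_pMl ?ltcR.
pose mu i := (sup L)^-1%:C * lam i.
have muE z : `|linear_form mu z| = (sup L)^-1%:C * `|linear_form lam z|.
  rewrite -[(sup L)^-1]gtr0_norm ?invr_gt0// -normc_real -normrM.
  congr `|_|; rewrite /linear_form mulr_sumr.
  by apply: eq_bigr => i _; rewrite mulrA.
exists mu; split=> [z Qz|s s1].
  by rewrite muE fmorphV/= ltr_pdivrMl ?ltcR// mulr1 ltM.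
have sM : 0 < (1 - s) * sup L by rewrite mulr_gt0// subr_gt0.
have [_ [z Qz <-] hz] := sup_adherent sM supL.
exists z => //; rewrite muE fmorphV/= ltr_pdivlMl ?ltcR//.
rewrite (@normr_ReE _ R[i]) -rmorphM/= ltcR.
by move: hz; rewrite mulrBl mul1r subKr mulrC.
Qed.

End NormingFunctional.

(** * Extremal functions *)

Section SharpnessExample.
Variables (R : realType) (H : normedModType R[i]) (n : nat).
Variable lam : 'I_n -> R[i].
Implicit Types (al : {ffun 'I_n -> nat}) (z : 'rV[R[i]]_n).

Definition multinomial_count (k : nat) al : nat :=
  #|[pred s : {ffun 'I_k -> 'I_n} | [forall i, #|[pred j | s j == i]| == al i]]|.

(* The coefficient of z^al in b_k l(z)^k, k = |al|; multinomial_count is the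
   multinomial coefficient. *)
Definition linear_form_coef (b : nat -> R[i]) al : bounded_operator H :=
  let k := (\sum_i al i)%N in
  (b k * (multinomial_count k al)%:R * \prod_i lam i ^+ al i) *: bop_id H.

(** This is the multinomial theorem: the k-th power expands over words of length k in the n indices,
    and the words are grouped by how often each index occurs. *)
Lemma homogeneous_part_linear_form (b : nat -> R[i]) k z :
  homogeneous_part (linear_form_coef b) k z =
  (b k * linear_form lam z ^+ k) *: bop_id H.
Proof.
pose cnt (s : {ffun 'I_k -> 'I_n}) i := #|[pred j | s j == i]|.
have cnt_lt s i : (cnt s i < k.+1)%N.
  by rewrite ltnS -[k in leqRHS]card_ord max_card.
pose cnt_ord (s : {ffun 'I_k -> 'I_n}) := [ffun i => Ordinal (cnt_lt s i)].
have sum_cnt s : (\sum_i cnt s i)%N = k.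
  rewrite -[RHS](card_ord k) -sum1_card (partition_big s xpredT)//=.
  by apply: eq_bigr => i _; rewrite sum1_card; apply: eq_card => j; rewrite !inE.
have expand : linear_form lam z ^+ k =
    \sum_(a : {ffun 'I_n -> 'I_k.+1} | (\sum_i a i)%N == k)
     (multinomial_count k [ffun i => val (a i)])%:R *
     \prod_i (lam i * z ord0 i) ^+ a i.
  have -> : linear_form lam z ^+ k = \prod_(j < k) linear_form lam z.
    by rewrite prodr_const card_ord.
  rewrite bigA_distr_bigA/=.
  rewrite (partition_big cnt_ord (fun a => (\sum_i a i)%N == k))/=; last first.
    move=> s _; rewrite -[X in _ == X](sum_cnt s); apply/eqP.
    by apply: eq_bigr => i _; rewrite ffunE.
  apply: eq_bigr => a _; rewrite /multinomial_count mulr_natl -sumr_const.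
  apply: eq_big => [s|s /eqP <-].
    rewrite inE; apply/eqP/forallP => [<- i|cnt_a].
      by rewrite !ffunE.
    by apply/ffunP => i; apply/val_inj; have /eqP := cnt_a i; rewrite !ffunE.
  rewrite (partition_big s xpredT)//=; apply: eq_bigr => i _.
  rewrite ffunE /=.
  rewrite (eq_bigr (fun=> lam i * z ord0 i)) => [|j /eqP ->//].
  by rewrite prodr_const; congr (_ ^+ _); apply: eq_card => j; rewrite !inE.
rewrite expand mulr_sumr scaler_suml; apply: eq_bigr => a /eqP ak.
have ak' : (\sum_i [ffun i => val (a i)] i)%N = k.
  by rewrite -[RHS]ak; apply: eq_bigr => i _; rewrite ffunE.
rewrite /linear_form_coef ak' scalerA; congr (_ *: _).
rewrite [RHS]mulrA mulrCA; congr (_ * _); rewrite mulrC -big_split/=.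
apply: eq_bigr => i _.
by rewrite ffunE exprMn.
Qed.

End SharpnessExample.

Section Blaschke.
Variable (F : fieldType).
Implicit Types (a w : F).

Definition blaschke a w : F := (a - w) / (1 - a * w).

(** The Taylor coefficients of [blaschke a] at 0. *)
Definition blaschke_coef a k : F :=
  if k is k'.+1 then - (1 - a ^+ 2) * a ^+ k' else a.

(** The exact remainder, over any field, serves both for convergence at complex w and for the
    majorant at a real point. *)
Lemma blaschke_partial_sum a w N : 1 - a * w != 0 ->
  \sum_(k < N.+1) blaschke_coef a k * w ^+ k =
  blaschke a w + (1 - a ^+ 2) * w / (1 - a * w) * (a * w) ^+ N.
Proof.
move=> aw; elim: N => [|N IH].
  by rewrite big_ord1 /blaschke /= !expr0 !mulr1; field.
rewrite big_ord_recr/= IH -addrA; congr (_ + _); apply: (mulIf aw).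
rewrite mulrDl -!mulrA [_^-1 * _]mulrCA mulVf// mulr1.
rewrite [_^-1 * (_ * _)]mulrCA mulVf// mulr1 !exprMn !(exprS _ N); ring.
Qed.

End Blaschke.

Lemma mobius_denominator_neq0 (F : numFieldType) (a w : F) :
  `|a| < 1 -> `|w| < 1 -> 1 - a * w != 0.
Proof.
move=> a1 w1; rewrite subr_eq0; apply/eqP => aw.
have := mulr_ilt1 (normr_ge0 a) (normr_ge0 w) a1 w1.
by rewrite -normrM -aw normr1 ltxx.
Qed.

(** The classical identity |1 - a w|^2 - |a - w|^2 = (1 - a^2) (1 - |w|^2), whose right side is
    positive. *)
Lemma normr_blaschke_lt1 (C : numClosedFieldType) (a w : C) :
  0 <= a -> a < 1 -> `|w| < 1 -> `|blaschke a w| < 1.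
Proof.
move=> a0 a1 w1.
have aw : 1 - a * w != 0 by rewrite mobius_denominator_neq0 ?(ger0_norm a0).
rewrite /blaschke normrM normfV ltr_pdivrMr ?normr_gt0// mul1r.
rewrite -ltr_sqr ?nnegrE// -subr_gt0.
have -> : `|1 - a * w| ^+ 2 - `|a - w| ^+ 2 = (1 - a ^+ 2) * (1 - `|w| ^+ 2).
  rewrite !normCK !rmorphB rmorphM rmorph1 /= (CrealP (ger0_real a0)); ring.
by rewrite mulr_gt0// subr_gt0 expr_lt1.
Qed.

Lemma normr_bop_id (R : realType) (H : normedModType R[i]) :
  (exists x : H, x != 0) -> `|bop_id H| = 1.
Proof.
move=> [x x0]; apply/le_anti/andP; split.
  by apply: normr_bop_le => // y; rewrite mul1r.
by have := le_normr_bop (bop_id H) x; rewrite ler_pMl ?normr_gt0.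
Qed.

Lemma bohr_function_blaschke (R : realType) (H : normedModType R[i]) (n : nat)
    (Q : set 'rV[R[i]]_n) (lam : 'I_n -> R[i]) (a : R) :
  (exists x : H, x != 0) ->
  (forall z, Q z -> `|linear_form lam z| < 1) -> 0 <= a -> a < 1 ->
  bohr_function Q (fun z => blaschke a%:C (linear_form lam z) *: bop_id H)
    (linear_form_coef H lam (blaschke_coef a%:C)) a%:C.
Proof.
move=> H0 hlam a0 a1.
have ca0 : 0 <= (a%:C : R[i]) by rewrite lecR.
have ca1 : (a%:C : R[i]) < 1 by rewrite ltcR.
have id1 := normr_bop_id H0; split.
- move=> z Qz; set w := linear_form lam z.
  have w1 : `|w| < 1 by exact: hlam.
  have aw : 1 - a%:C * w != 0 by rewrite mobius_denominator_neq0 ?(ger0_norm ca0).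
  have aw1 : `|a%:C * w| < 1 by rewrite normrM mulr_ilt1 ?(ger0_norm ca0).
  apply/cvgrPdist_le => e e0.
  pose c := `|(1 - a%:C ^+ 2) * w / (1 - a%:C * w)|.
  have c0 : 0 < c + 1 by rewrite ltr_wpDl// normr_ge0.
  have [m hm] := exists_exprn_le (normr_ge0 _) aw1 (divr_gt0 e0 c0).
  (* The shift by one: the remainder after N + 1 terms carries the power N. *)
  exists m.+1 => // -[//|N] /= mN.
  rewrite /series/= big_mkord.
  under eq_bigr do rewrite homogeneous_part_linear_form -/w.
  rewrite -scaler_suml blaschke_partial_sum// -scalerBl opprD addNKr normrZ id1.
  rewrite mulr1 normrN normrM normrX -/c.
  apply: (le_trans (ler_wpM2l (normr_ge0 _) (hm N mN))).
  by rewrite mulrCA ler_piMr ?(ltW e0)// ler_pdivrMr// mul1r lerDl ler01.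
- move=> z Qz; rewrite normrZ id1 mulr1.
  by rewrite normr_blaschke_lt1 ?hlam.
- congr (_ *: _); rewrite /linear_form big1 => [|i _]; last by rewrite mxE mulr0.
  by rewrite /blaschke mulr0 !subr0 divr1.
- by rewrite ger0_norm.
Qed.

Lemma majorant_sum_blaschke_ge1 (R : realType) (H : normedModType R[i]) (n : nat)
    (lam : 'I_n -> R[i]) (z : 'rV[R[i]]_n) (a t : R) :
  (exists x : H, x != 0) -> 0 < a -> a < 1 -> 0 < t -> t < 1 ->
  1 < t * (1 + 2 * a) -> `|linear_form lam z| = t%:C ->
  ~ (majorant_sum (linear_form_coef H lam (blaschke_coef a%:C)) z < 1)%E.
Proof.
move=> H0 a0 a1 t0 t1 hat zt; apply/negP; rewrite -leNgt.
have at0 : 0 < 1 - a * t by nra.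
have at1 : `|a * t| < 1 by rewrite gtr0_norm ?mulr_gt0//; lra.
(* The partial sum of N + 1 terms reaches 1 exactly when (a t)^N <= d, and d > 0 amounts to 1 < t (1
   + 2 a). *)
pose d := 1 - (1 - a * t) / ((1 + a) * t).
have D0 : 0 < (1 + a) * t by rewrite mulr_gt0// addr_gt0.
have d0 : 0 < d by rewrite subr_gt0 ltr_pdivrMr//; nra.
have /cvgrPdist_le/(_ _ d0)[N _ /(_ N (leqnn N))] := cvg_expr at1.
rewrite /= sub0r normrN ger0_norm ?exprn_ge0 ?mulr_ge0 ?(ltW a0) ?(ltW t0)// => hN.
have opE k : opnorm (homogeneous_part
    (linear_form_coef H lam (blaschke_coef a%:C)) k z) = `|blaschke_coef a k| * t ^+ k.
  apply: complexI; rewrite -bop_normE homogeneous_part_linear_form normrZ.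
  rewrite normr_bop_id// mulr1 normrM normrX zt rmorphM rmorphXn/= -normc_real.
  congr (`|_| * _); case: k => //= k.
  by rewrite rmorphM rmorphN rmorphB rmorphXn rmorph1 rmorphXn.
(* The terms are nonnegative, so a single partial sum bounds the series from below. *)
apply: (le_trans (y := (\sum_(0 <= k < N.+1) (opnorm
  (homogeneous_part (linear_form_coef H lam (blaschke_coef a%:C)) k z))%:E)%E));
  last first.
  by apply: nneseries_lim_ge => k _ _; rewrite lee_fin opnorm_ge0.
rewrite sumEFin lee_fin big_mkord.
under eq_bigr do rewrite opE.
(* All coefficients after the first are nonpositive, so taking moduli reflects the sum about a. *)
have -> : \sum_(k < N.+1) `|blaschke_coef a k| * t ^+ k =
    2 * a - \sum_(k < N.+1) blaschke_coef a k * t ^+ k.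
  rewrite !big_ord_recl/= !expr0 !mulr1 (gtr0_norm a0) [- (a + _)]opprD addrA.
  congr (_ + _); first by ring.
  rewrite -sumrN; apply: eq_bigr => k _.
  rewrite mulNr normrN ger0_norm ?mulNr ?opprK//.
  by rewrite mulr_ge0 ?exprn_ge0 ?(ltW a0)// subr_ge0 expr_le1 ?ltW.
rewrite blaschke_partial_sum ?(gt_eqF at0)// /blaschke.
have {}hN : (1 - a ^+ 2) * t * (a * t) ^+ N <=
    (1 - a ^+ 2) * t - (1 - a) * (1 - a * t).
  have -> : (1 - a ^+ 2) * t - (1 - a) * (1 - a * t) = (1 - a ^+ 2) * t * d.
    by rewrite /d; field; rewrite !gt_eqF// addr_gt0.
  by rewrite ler_wpM2l// mulr_ge0 ?(ltW t0)// subr_ge0 expr_le1 ?ltW.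
rewrite [X in _ - (_ + X)]mulrAC -mulrDl lerBrDr -lerBrDl ler_pdivrMr//.
nra.
Qed.

(** * Bohr's inequality and the optimality of 1/3 *)

Unset Implicit Arguments.

Theorem theorem2p1 (R : realType) (H : completeNormedModType R[i])
    (dot : {dot H for Num.conj}) (Hdot : hilbert_product dot)
    (n : nat) (Q : set 'rV[R[i]]_n) (HQ : complete_circular_domain Q) :
  (forall (f : 'rV[R[i]]_n -> bounded_operator H)
      (A : {ffun 'I_n -> nat} -> bounded_operator H) (a0 : R[i]),
    bohr_function Q f A a0 ->
    forall z, homothetic (3^-1) Q z -> (majorant_sum A z < 1)%E)
  /\
  ((exists x : H, x != 0) -> Q != setT -> convex_set Q ->
    forall rho : R, 3^-1 < rho -> rho < 1 ->
    exists (f : 'rV[R[i]]_n -> bounded_operator H)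
      (A : {ffun 'I_n -> nat} -> bounded_operator H) (a0 : R[i]),
      bohr_function Q f A a0 /\
      exists2 z, homothetic rho Q z & ~ (majorant_sum A z < 1)%E).
Proof.
split=> [f A a0 fA z|H0 QT cQ rho rho3 rho1].
  exact: (bohr_inequality Hdot HQ fA).
have [lam [lam_lt1 lam_sup]] := exists_norming_linear_form HQ cQ QT.
have rho0 : 0 < rho by rewrite (lt_trans _ rho3)// invr_gt0.
(* Scaling by rho takes a point with |l| > 1 / (3 rho) to one with |l| > 1/3. *)
have [|z Qz hz] := lam_sup (3^-1 / rho); first by rewrite ltr_pdivrMr// mul1r.
pose t := rho * complex.Re `|linear_form lam z|.
have t3 : 3^-1 < t.
  by move: hz; rewrite (@normr_ReE _ R[i]) ltcR ltr_pdivrMr// mulrC.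
have t1 : t < 1.
  have := lam_lt1 z Qz; rewrite (@normr_ReE _ R[i]) ltcR /t; nra.
have t0 : 0 < t by rewrite (lt_trans _ t3)// invr_gt0.
have zt : `|linear_form lam (rho%:C *: z)| = t%:C.
  by rewrite linear_formZ normrM normc_real (gtr0_norm rho0)
    (@normr_ReE _ R[i] (linear_form lam z)) -rmorphM.
have [a [a0 a1 hat]] : exists a, [/\ 0 < a, a < 1 & 1 < t * (1 + 2 * a)].
  have it1 : 1 < t^-1 by rewrite invf_gt1.
  have it3 : t^-1 < 3 by rewrite invf_plt ?posrE//.
  (* The midpoint of 1 and (1 / t - 1) / 2; the latter is the threshold for 1 < t (1 + 2 a) and is
     below 1 because t > 1/3. *)
  exists (((t^-1 - 1) / 2 + 1) / 2); split; [lra | lra |].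
  by rewrite -ltr_pdivrMl// mulr1; lra.
exists (fun z => blaschke a%:C (linear_form lam z) *: bop_id H),
  (linear_form_coef H lam (blaschke_coef a%:C)), a%:C; split.
  exact: bohr_function_blaschke H0 lam_lt1 (ltW a0) a1.
exists (rho%:C *: z); first by exists z.
exact: (majorant_sum_blaschke_ge1 H0 a0 a1 t0 t1 hat zt).
Qed.
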